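(* Let $D\subsetneq\mathbb{R}^n$ be a domain. Then for all $x,y\in D$ we have $$\tilde j_D(x,y)\le u_D(x,y)\le 4\tilde j_D(x,y).$$ The first inequality is sharp, i.e. there is no constant $C<1$ such that $\tilde j_D(x,y)\le C\,u_D(x,y)$ for all domains $D\subsetneq\mathbb{R}^n$ and all $x,y\in D$.
   Context: Here $n\ge2$, a domain is an open connected nonempty set, the boundary $\partial D$ is taken in $\mathbb{R}^n$ and $d(x)=\mathrm{dist}(x,\partial D)$. For $x,y\in D$, $$\tilde j_D(x,y)=\log\left(1+\frac{|x-y|}{\min\{d(x),d(y)\}}\right),\qquad u_D(x,y)=2\log\frac{|x-y|+\max\{d(x),d(y)\}}{\sqrt{d(x)d(y)}}.$$ *)

(* Defs.v *)
From HB Require Import structures.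
From mathcomp Require Import all_boot all_order all_algebra.
From mathcomp Require Import all_classical all_reals all_analysis.

Set Implicit Arguments.
Unset Strict Implicit.
Unset Printing Implicit Defensive.

Import Order.TTheory GRing.Theory Num.Theory.
Import numFieldNormedType.Exports.

Local Open Scope classical_set_scope.
Local Open Scope ring_scope.

(* R^n is 'rV[R]_n.  The norm `|x| of MathComp-Analysis on 'rV[R]_n is the
   sup norm, so the Euclidean norm is defined here; both norms induce the
   topology of 'rV[R]_n used for open, connected, closure and interior. *)
Definition enorm (R : realType) (n : nat) (x : 'rV[R]_n) : R :=
  Num.sqrt (\sum_(i < n) x ord0 i ^+ 2).

Definition domain (R : realType) (n : nat) (D : set 'rV[R]_n) : Prop :=
  [/\ open D, connected D & D !=set0].

Definition boundary (R : realType) (n : nat) (D : set 'rV[R]_n) :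
    set 'rV[R]_n :=
  closure D `\` interior D.

Definition set_dist (R : realType) (n : nat) (x : 'rV[R]_n)
    (A : set 'rV[R]_n) : R :=
  inf [set enorm (x - z) | z in A].

Definition bdist (R : realType) (n : nat) (D : set 'rV[R]_n) (x : 'rV[R]_n) : R :=
  set_dist x (boundary D).

Definition jtilde (R : realType) (n : nat) (D : set 'rV[R]_n)
    (x y : 'rV[R]_n) : R :=
  ln (1 + enorm (x - y) / Num.min (bdist D x) (bdist D y)).

Definition umetric (R : realType) (n : nat) (D : set 'rV[R]_n)
    (x y : 'rV[R]_n) : R :=
  2 * ln ((enorm (x - y) + Num.max (bdist D x) (bdist D y)) /
          Num.sqrt (bdist D x * bdist D y)).

(* Main.v *)
(* Write a <= b for the two boundary distances, t = |x - y| and s = t / a.  As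
   the boundary distance is 1-Lipschitz, a <= b <= (1 + s) a, so
   1 + s <= (t + b)^2 / (a b) <= (1 + s)^3, and taking logarithms gives both
   inequalities.  For sharpness, take points at heights 1 and M over the same
   boundary point of a half-space: there jtilde = ln M and umetric <= ln (4 M),
   so the ratio tends to 1 as M grows. *)
Require Import Defs.
From mathcomp Require Import all_boot all_order all_algebra.
From mathcomp Require Import all_classical all_reals all_analysis.
From mathcomp Require Import ring lra.
Import Order.TTheory GRing.Theory Num.Theory.
Import numFieldNormedType.Exports.
Local Open Scope classical_set_scope.
Local Open Scope ring_scope.

Lemma enorm_ge0 (R : realType) (n : nat) (x : 'rV[R]_n) : 0 <= enorm x.
Proof. exact: sqrtr_ge0. Qed.

Lemma enormN (R : realType) (n : nat) (x : 'rV[R]_n) : enorm (- x) = enorm x.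
Proof. by congr Num.sqrt; apply: eq_bigr => i _; rewrite mxE sqrrN. Qed.

Lemma sqr_enorm (R : realType) (n : nat) (x : 'rV[R]_n) :
  enorm x ^+ 2 = \sum_(i < n) x ord0 i ^+ 2.
Proof. by rewrite sqr_sqrtr// sumr_ge0// => i _; exact: sqr_ge0. Qed.

(** Comparison with the sup norm: this is what carries Euclidean estimates over to the balls
    defining the topology. *)
Lemma le_enorm_coord (R : realType) (n : nat) (x : 'rV[R]_n) (i : 'I_n) :
  `|x ord0 i| <= enorm x.
Proof.
rewrite -(@ler_pXn2r _ 2)// ?nnegrE ?enorm_ge0// sqr_enorm.
rewrite real_normK ?num_real// (bigD1 i)//= lerDl.
by rewrite sumr_ge0// => j _; exact: sqr_ge0.
Qed.

Lemma enorm_scale_delta (R : realType) (n : nat) (c : R) (i : 'I_n) :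
  enorm (c *: delta_mx ord0 i) = `|c|.
Proof.
rewrite /enorm (bigD1 i)//= big1 ?addr0 => [|j ji].
  by rewrite !mxE !eqxx mulr1 sqrtr_sqr.
by rewrite !mxE (negbTE ji) andbF mulr0 expr0n.
Qed.

(* Lagrange's identity gives the Cauchy-Schwarz inequality. *)
Lemma dot_le_enorm (R : realType) (n : nat) (u v : 'rV[R]_n) :
  \sum_(i < n) u ord0 i * v ord0 i <= enorm u * enorm v.
Proof.
rewrite (le_trans (ler_norm _))//.
rewrite -(@ler_pXn2r _ 2)// ?nnegrE ?mulr_ge0 ?enorm_ge0//.
rewrite real_normK ?num_real// exprMn !sqr_enorm -subr_ge0.
(* The sum over all ordered pairs (i, j) counts each unordered pair twice, hence the doubling of
   [S]. *)
set S := (X in 0 <= X); rewrite -(@pmulrn_lge0 _ S 2)//.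
suff -> : S *+ 2 = \sum_(i < n) \sum_(j < n)
    (u ord0 i * v ord0 j - u ord0 j * v ord0 i) ^+ 2.
  by apply: sumr_ge0 => i _; apply: sumr_ge0 => j _; exact: sqr_ge0.
(* Writing both [a * b] and [b * a] makes the two double sums symmetric in i and j, so that they
   match the expanded squares term by term. *)
have -> (a b c : R) : (a * b - c ^+ 2) *+ 2 = a * b - c * c + (b * a - c * c).
  by ring.
rewrite !big_distrlr/= -!sumrB -big_split/=.
apply: eq_bigr => i _; rewrite -!sumrB -big_split/=.
by apply: eq_bigr => j _; ring.
Qed.

Lemma ler_enormD (R : realType) (n : nat) (u v : 'rV[R]_n) :
  enorm (u + v) <= enorm u + enorm v.
Proof.
rewrite -(@ler_pXn2r _ 2)// ?nnegrE ?addr_ge0 ?enorm_ge0//.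
rewrite sqrrD !sqr_enorm.
rewrite (eq_bigr (fun i => u ord0 i ^+ 2 + (u ord0 i * v ord0 i) *+ 2 +
    v ord0 i ^+ 2)) => [|i _]; last by rewrite mxE sqrrD.
rewrite !big_split/= lerD2r lerD2l mulr2n lerD//; exact: dot_le_enorm.
Qed.

(** A nonempty convex set is the union of the segments from one fixed point; these are continuous
    images of [0, 1] sharing that point. *)
Lemma convex_connected (R : realType) (n : nat) (A : set 'rV[R]_n) :
  (forall x y, A x -> A y -> forall t, 0 <= t <= 1 -> A (x + t *: (y - x))) ->
  connected A.
Proof.
move=> cA; have [[x Ax]|/set0P/negP/negPn/eqP->] := pselect (A !=set0);
  last exact: connected0.
pose seg y := [set x + t *: (y - x) | t in `[0, 1]%classic : set R].
have -> : A = \bigcup_(y in A) seg y.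
  apply/seteqP; split=> [y Ay|_ [y Ay [t t01 <-]]].
    exists y => //; exists 1; last by rewrite scale1r addrC subrK.
    by rewrite /= in_itv/= ler01 lexx.
  by apply: cA => //; move: t01; rewrite /= in_itv.
apply: bigcup_connected => [|y Ay].
  exists x => y Ay; exists 0; last by rewrite scale0r addr0.
  by rewrite /= in_itv/= ler01 lexx.
apply: connected_continuous_connected; first exact: segment_connected.
apply: continuous_subspaceT => t.
apply: cvgD; first exact: cvg_cst.
by apply: cvgZr_tmp; exact: cvg_id.
Qed.

(** With empty boundary, D would be open and closed, hence the whole connected space. Since the
    infimum of the empty set is 0 by default, this is what makes [bdist] a genuine distance. *)
Lemma boundary_nonempty (R : realType) (n : nat) (D : set 'rV[R]_n) :
  domain D -> D `<` setT -> boundary D !=set0.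
Proof.
move=> [oD _ D0] [_ DT]; apply/set0P/eqP; rewrite /boundary (interior_id _).1//.
rewrite setD_eq0 => cD; apply: DT.
have cT : connected [set: 'rV[R]_n] by exact: convex_connected.
by rewrite (cT D D0)//; exists D; rewrite // setTI.
Qed.

Lemma has_lbound_dist (R : realType) (n : nat) (x : 'rV[R]_n)
  (A : set 'rV[R]_n) : has_lbound [set enorm (x - z) | z in A].
Proof. by exists 0 => _ [z _ <-]; exact: enorm_ge0. Qed.

Lemma set_dist_lipschitz (R : realType) (n : nat) (A : set 'rV[R]_n)
    (x y : 'rV[R]_n) : A !=set0 ->
  `|set_dist x A - set_dist y A| <= enorm (x - y).
Proof.
move=> [a Aa].
(* By symmetry a one-sided bound suffices; it is the triangle inequality through each point of [A],
   followed by the infimum. *)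
suff H u v : set_dist u A <= set_dist v A + enorm (u - v).
  rewrite ler_distl lerBlDr H andbT.
  by rewrite -[enorm _]enormN opprB H.
rewrite -lerBlDr; apply: lb_le_inf => [|_ [z Az <-]].
  by exists (enorm (v - a)), a.
rewrite lerBlDr (@le_trans _ _ (enorm (u - z)))//.
  by apply: ge_inf; [exact: has_lbound_dist|exists z].
by rewrite [leRHS]addrC -[u - z](subrKA v) ler_enormD.
Qed.

(** Some sup-norm ball of radius e around x lies in D, while boundary points lie outside the open
    set D; their Euclidean distance to x, at least the sup distance, is therefore at least e. *)
Lemma bdist_gt0 (R : realType) (n : nat) (D : set 'rV[R]_n) (x : 'rV[R]_n) :
  open D -> boundary D !=set0 -> D x -> 0 < bdist D x.
Proof.
move=> oD [a Da] Dx.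
have /nbhs_ballP[e/= e0 eD] : nbhs x D by exact: open_nbhs_nbhs.
apply: (lt_le_trans e0); apply: lb_le_inf; first by exists (enorm (x - a)), a.
move=> _ [z [_ Dz] <-]; rewrite leNgt; apply/negP => xze; apply: Dz.
rewrite (interior_id _).1//; apply: eD; split => // i j.
rewrite ord1; apply: le_lt_trans xze.
by have := @le_enorm_coord R n (x - z) j; rewrite !mxE.
Qed.

(** The analytic core: the only geometric input is the Lipschitz bound on the two boundary
    distances. *)
Lemma ln_bounds (R : realType) (a b t : R) : 0 < a -> 0 < b ->
    `|a - b| <= t ->
  ln (1 + t / Num.min a b) <= 2 * ln ((t + Num.max a b) / Num.sqrt (a * b))
    <= 4 * ln (1 + t / Num.min a b).
Proof.
move=> a0 b0; wlog ab : a b a0 b0 / a <= b => [H|].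
  have /orP[ab|ba] := le_total a b; first exact: H.
  rewrite distrC => abt; have := H _ _ b0 a0 ba abt.
  by rewrite minC maxC (mulrC a).
rewrite distrC ger0_norm ?subr_ge0// (min_idPl ab) (max_idPr ab) => bt.
have t0 : 0 <= t by lra.
have s0 : 0 < Num.sqrt (a * b) by rewrite sqrtr_gt0 mulr_gt0.
have w0 : 0 < (t + b) / Num.sqrt (a * b) by rewrite divr_gt0//; lra.
have j0 : 0 < 1 + t / a by rewrite ltr_pwDl// divr_ge0// ltW.
have -> : 2 * ln ((t + b) / Num.sqrt (a * b)) = ln ((t + b) ^+ 2 / (a * b)).
  by rewrite mulr_natl -lnXn// expr_div_n sqr_sqrtr// mulr_ge0// ltW.
have q0 : 0 < (t + b) ^+ 2 / (a * b).
  by rewrite divr_gt0 ?exprn_gt0 ?mulr_gt0//; lra.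
rewrite mulr_natl -lnXn// !ler_ln ?posrE ?exprn_gt0//.
have e : 1 + t / a = (a + t) / a by rewrite mulrDl divff// gt_eqF.
apply/andP; split.
  (* Clearing denominators leaves (a + t) b <= (t + b)^2, where a + t and b are both at most t +
     b. *)
  rewrite e ler_pdivlMr ?mulr_gt0//.
  rewrite [X in X <= _](_ : _ = (a + t) * b); first by nra.
  by field; rewrite gt_eqF.
set s := t / a.
have s_ge0 : 0 <= s by rewrite divr_ge0// ltW.
have ts : t = s * a by rewrite /s divfK// gt_eqF.
have bs : b <= (1 + s) * a by lra.
(* [(t + b)^2 / (a b) <= ((1 + s) b) (1 + 2 s) a / (a b)] and [1 + 2 s <= (1 + s)^2]. *)
have h1 : t + b <= (1 + s) * b by rewrite ts; nra.
have h2 : t + b <= (1 + s) ^+ 2 * a.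
  have : 0 <= s ^+ 2 * a by rewrite mulr_ge0 ?sqr_ge0// ltW.
  by rewrite ts; nra.
rewrite ler_pdivrMr ?mulr_gt0//.
apply: (@le_trans _ _ ((1 + s) ^+ 3 * (a * b))).
  rewrite [X in _ <= X](_ : _ = (1 + s) * b * ((1 + s) ^+ 2 * a)); last by ring.
  by rewrite expr2 ler_pM//; lra.
(* The exponent 3 is relaxed to 4, as 1 + s >= 1. *)
rewrite ler_pM2r ?mulr_gt0//.
by rewrite ler_weXn2l// lerDl.
Qed.

(** The test domain for sharpness, where the boundary distance is just a coordinate. *)
Definition half_space (R : realType) (n : nat) (i : 'I_n) : set 'rV[R]_n :=
  [set x | 0 < x ord0 i].
Arguments half_space R {n} i.

Lemma open_half_space (R : realType) (n : nat) (i : 'I_n) :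
  open (half_space R i).
Proof.
apply: (@open_comp _ _ (fun x : 'rV[R]_n => x ord0 i) [set r | 0 < r]).
  by move=> x _; exact: coord_continuous.
exact: open_gt.
Qed.

Lemma domain_half_space (R : realType) (n : nat) (i : 'I_n) :
  domain (half_space R i).
Proof.
split; first exact: open_half_space.
  apply: convex_connected => x y; rewrite /half_space/= => x0 y0 t.
  by move=> /andP[t0 t1]; rewrite !mxE; nra.
by exists (delta_mx ord0 i); rewrite /half_space/= mxE !eqxx.
Qed.

Lemma half_space_proper (R : realType) (n : nat) (i : 'I_n) :
  half_space R i `<` setT.
Proof.
by split=> // /(_ 0 I); rewrite /half_space/= mxE ltxx.
Qed.

(** The foot [p] of the perpendicular from x is a boundary point, giving the upper bound. Boundary
    points z have z_i <= 0, so |x - z| >= x_i - z_i >= x_i. *)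
Lemma bdist_half_space (R : realType) (n : nat) (i : 'I_n) (x : 'rV[R]_n) :
  half_space R i x -> bdist (half_space R i) x = x ord0 i.
Proof.
move=> x0; pose p := x - x ord0 i *: delta_mx ord0 i.
have bp : boundary (half_space R i) p.
  split; last first.
    move=> /interior_subset; rewrite /half_space/= !mxE !eqxx.
    by rewrite mulr1 subrr ltxx.
  move=> B /nbhs_ballP[e/= e0 eB].
  (* Moving [p] inwards by e / 2 enters the half-space without leaving the ball. *)
  exists (p + (e / 2) *: delta_mx ord0 i); split.
    by rewrite /half_space/= !mxE !eqxx !mulr1 subrr add0r divr_gt0.
  apply: eB; split => // k j; rewrite ord1 /ball/= [X in _ - X]mxE.
  rewrite opprD addNKr normrN !mxE normrM gtr0_norm ?divr_gt0//.
  by case: (j == i); rewrite ?andbF/= ?normr1 ?normr0; lra.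
apply/eqP; rewrite eq_le; apply/andP; split.
  apply: ge_inf; first exact: has_lbound_dist.
  exists p => //; rewrite opprB addrCA subrr addr0 enorm_scale_delta.
  by rewrite gtr0_norm.
apply: lb_le_inf; first by exists (enorm (x - p)), p.
move=> _ [z [_ Hz] <-]; apply: le_trans (@le_enorm_coord _ _ _ i).
rewrite !mxE (le_trans _ (ler_norm _))// lerDl oppr_ge0 leNgt.
by apply/negP => z0; apply: Hz; rewrite (interior_id _).1//; exact: open_half_space.
Qed.

Theorem theorem4p8 (R : realType) (n : nat) (hn : (2 <= n)%N) :
  (forall D : set 'rV[R]_n, domain D -> D `<` setT ->
     forall x y : 'rV[R]_n, D x -> D y ->
       jtilde D x y <= umetric D x y /\ umetric D x y <= 4 * jtilde D x y)
  /\
  ~ (exists C : R, C < 1 /\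
       forall D : set 'rV[R]_n, domain D -> D `<` setT ->
         forall x y : 'rV[R]_n, D x -> D y ->
           jtilde D x y <= C * umetric D x y).
Proof.
have bounds (D : set 'rV[R]_n) : domain D -> D `<` setT ->
    forall x y : 'rV[R]_n, D x -> D y ->
      jtilde D x y <= umetric D x y /\ umetric D x y <= 4 * jtilde D x y.
  move=> dD DT x y Dx Dy.
  have bD := @boundary_nonempty _ _ D dD DT.
  have oD : open D by case: dD.
  have x0 := @bdist_gt0 _ _ D x oD bD Dx.
  have y0 := @bdist_gt0 _ _ D y oD bD Dy.
  by apply/andP; apply: ln_bounds => //; exact: set_dist_lipschitz.
split=> [//|[C [C1 HC]]].
pose i : 'I_n := Ordinal (ltnW hn).
(* Replacing [C] by a nonnegative constant allows upper bounds on [umetric] to be multiplied by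
   it. *)
pose c := Num.max C 0.
have c0 : 0 <= c by rewrite le_max lexx orbT.
have c1 : c < 1 by rewrite gt_max C1 ltr01.
pose k := Num.bound (1 - c)^-1.
have kc : 1 < k%:R * (1 - c).
  rewrite -ltr_pdivrMr ?subr_gt0// div1r.
  by rewrite archi_boundP// invr_ge0 subr_ge0 ltW.
(* With a power of 4, ln M = k ln 4 and ln (4 M) = (k + 1) ln 4, so only k and k + 1 remain to be
   compared. *)
pose M : R := 4 ^+ k.
have M1 : 1 <= M by rewrite exprn_ege1//; lra.
pose x (r : R) : 'rV[R]_n := r *: delta_mx ord0 i.
have xi r : x r ord0 i = r by rewrite !mxE !eqxx mulr1.
have Hx r : 0 < r -> half_space R i (x r) by rewrite /half_space/= xi.
have dx r : 0 < r -> bdist (half_space R i) (x r) = r.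
  by move=> r0; rewrite bdist_half_space ?xi//; exact: Hx.
have M0 : 0 < M by lra.
have ln4 : 0 < ln (4 : R) by rewrite ln_gt0//; lra.
have xM : enorm (x 1 - x M) = M - 1.
  by rewrite -scalerBl enorm_scale_delta distrC ger0_norm// subr_ge0.
have jE : jtilde (half_space R i) (x 1) (x M) = k%:R * ln 4.
  rewrite /jtilde !dx// xM (min_idPl M1) divr1 addrC subrK /M lnXn; last by lra.
  by rewrite mulr_natl.
have uE : umetric (half_space R i) (x 1) (x M) <= (k%:R + 1) * ln 4.
  have s0 : 0 < Num.sqrt M by rewrite sqrtr_gt0.
  have sM : Num.sqrt M ^+ 2 = M by rewrite sqr_sqrtr// ltW.
  have -> : (k%:R + 1) * ln 4 = 2 * ln (2 * Num.sqrt M).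
    rewrite mulr_natl -lnXn ?mulr_gt0// exprMn sM -natrX -exprS lnXn; last by lra.
    by rewrite natr1 mulr_natl.
  (* The argument of the logarithm is (2 M - 1) / sqrt M, at most 2 sqrt M. *)
  rewrite /umetric !dx// xM (max_idPr M1) mul1r ler_pM2l//.
  rewrite ler_ln ?posrE ?divr_gt0 ?mulr_gt0//; last by lra.
  by rewrite ler_pdivrMr// -mulrA -expr2 sM; lra.
have dH := @domain_half_space R _ i.
have pH := @half_space_proper R _ i.
have H1 := Hx 1 ltr01; have HM := Hx M M0.
have ju := (bounds _ dH pH _ _ H1 HM).1.
have := HC _ dH pH _ _ H1 HM; rewrite jE in ju *.
set u := umetric _ _ _ in ju uE *.
have cC : C <= c by rewrite le_max lexx.
have u0 : 0 <= u by rewrite (le_trans _ ju)// mulr_ge0// ltW.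
move=> jCu.
have : k%:R * ln 4 <= c * (k%:R + 1) * ln (4 : R).
  rewrite (le_trans jCu)// (le_trans (ler_wpM2r u0 cC))//.
  by rewrite -mulrA ler_wpM2l.
(* Cancelling ln 4 gives k (1 - c) <= c < 1, contradicting [kc]. *)
by rewrite ler_pM2r//; lra.
Qed.
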